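(* Fix $1<p<2$, $\sigma>0$, $\iota>0$, $\varepsilon>0$. Let $X\in\mathbb{R}^{n\times d}$, $y\in\mathbb{R}^n$ with $X^\top X\succ mI_d$ for some $m>0$, let $M:=\|X^\top X\|_{\mathrm{op}}$, and let $$U(q)=\frac1{2\sigma^2}|y-Xq|^2+\iota\sum_{i=1}^d(q_i^2+\varepsilon^2)^{p/2},\qquad q\in\mathbb{R}^d.$$ Then: (a) $U\in C^\infty(\mathbb{R}^d)$, $U\ge0$, and $\nabla U$ is $L$-Lipschitz with $L:=\frac{M}{\sigma^2}+\iota p\,\varepsilon^{p-2}$. (b) $U$ is dissipative in the sense stated in the context. In particular, $\langle\nabla U(q),q\rangle\ge\frac{m}{2\sigma^2}|q|^2-\frac{|X^\top y|^2}{2m\sigma^2}$ for all $q\in\mathbb{R}^d$. (c) $U$ satisfies the asymptotically linear gradient assumption stated in the context with $Q_\infty:=\frac1{\sigma^2}X^\top X$ and $$\varrho(r):=\frac{c_0^{\mathrm{LR}}}{r}+c_1^{\mathrm{LR}}r^{p-2},\qquad r\ge C_{\mathrm{linear}},$$ where one may take $C_{\mathrm{linear}}:=1$ and $c_0^{\mathrm{LR}}:=\frac{|X^\top y|}{\sigma^2}+\iota p\sqrt d\,\varepsilon^{p-1}$, $c_1^{\mathrm{LR}}:=\iota p\,d^{\frac{2-p}{2}}$.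
   Context: $|\cdot|$ is the Euclidean norm and $\|\cdot\|_{\mathrm{op}}$ the operator norm; $\gamma>0$ is a fixed friction parameter. Dissipativity: there are $\lambda\in(0,1/4]$ and $A\in(0,\infty)$ such that $\frac12q\cdot\nabla U(q)\ge\lambda(U(q)+\frac{\gamma^2}{4}|q|^2)-A$ for all $q\in\mathbb{R}^d$. Asymptotically linear gradient assumption: there are $C_{\mathrm{linear}}>0$, a symmetric positive definite $Q_\infty\in\mathbb{R}^{d\times d}$ and a nonincreasing function $\varrho$ with $\varrho(r)\to0$ as $r\to\infty$ such that $|\nabla U(q)-Q_\infty q|\le\varrho(|q|)|q|$ for $|q|\ge C_{\mathrm{linear}}$ (only the values of $\varrho$ on $[C_{\mathrm{linear}},\infty)$ matter). *)

(* Defs.v *)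
From HB Require Import structures.
From mathcomp Require Import all_boot all_order all_algebra.
From mathcomp Require Import all_classical all_reals all_analysis.
Set Implicit Arguments.
Unset Strict Implicit.
Unset Printing Implicit Defensive.
Import Order.TTheory GRing.Theory Num.Theory.
Import numFieldNormedType.Exports.
Local Open Scope classical_set_scope.
Local Open Scope ring_scope.

Section Euclidean.
Context {R : realType}.

Definition dotv {d : nat} (u v : 'cV[R]_d) : R := (u^T *m v) 0 0.

(* The library norm on matrices is the max norm, hence this definition. *)
Definition enorm {d : nat} (u : 'cV[R]_d) : R := Num.sqrt (dotv u u).

(* The set is nonempty and bounded, so [sup] is a genuine supremum. *)
Definition opnorm {n d : nat} (A : 'M[R]_(n, d)) : R :=
  sup [set enorm (A *m u) | u in [set u : 'cV[R]_d | enorm u <= 1]].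

Definition posdefmx {d : nat} (A : 'M[R]_d) : Prop :=
  A^T = A /\ forall u : 'cV[R]_d, u != 0 -> 0 < dotv u (A *m u).

(* Strict Loewner order: A is greater than B. *)
Definition loewner_gt {d : nat} (A B : 'M[R]_d) : Prop := posdefmx (A - B).

End Euclidean.

Section Calculus.
Context {R : realType} {d : nat}.
Implicit Types f U : 'cV[R]_d -> R.

Definition partial f (i : 'I_d) : 'cV[R]_d -> R :=
  fun q => 'D_(delta_mx i 0) f q.

Definition grad f (q : 'cV[R]_d) : 'cV[R]_d := \col_i partial f i q.

(* All iterated partial derivatives of order at most k exist and are
   continuous on the whole space. *)
Fixpoint classC (k : nat) f : Prop :=
  continuous f /\
  if k is k'.+1 then
    forall i : 'I_d,
      (forall q, derivable f q (delta_mx i 0)) /\ classC k' (partial f i)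
  else True.

Definition smooth f : Prop := forall k : nat, classC k f.

(* Lipschitz with respect to the Euclidean norm; the library's [lipschitz]
   would use the max norm. *)
Definition elipschitz (L : R) (F : 'cV[R]_d -> 'cV[R]_d) : Prop :=
  forall q q' : 'cV[R]_d, enorm (F q - F q') <= L * enorm (q - q').

Definition dissipative (gamma : R) U : Prop :=
  exists lambda A : R,
    [/\ 0 < lambda, lambda <= 1 / 4, 0 < A &
        forall q : 'cV[R]_d,
          lambda * (U q + gamma ^+ 2 / 4 * enorm q ^+ 2) - A
            <= 1 / 2 * dotv q (grad U q)].

(* Only the values of rho on [C, +oo[ are constrained. *)
Definition asymptotically_linear_gradient U
    (C : R) (Q : 'M[R]_d) (rho : R -> R) : Prop :=
  [/\ 0 < C,
      posdefmx Q,
      (forall r s : R, C <= r -> r <= s -> rho s <= rho r),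
      rho r @[r --> +oo%R] --> (0 : R) &
      forall q : 'cV[R]_d, C <= enorm q ->
        enorm (grad U q - Q *m q) <= rho (enorm q) * enorm q].

End Calculus.

Definition bridge_potential {R : realType} {n d : nat} (p sigma iota eps : R)
    (X : 'M[R]_(n, d)) (y : 'cV[R]_n) (q : 'cV[R]_d) : R :=
  1 / (2 * sigma ^+ 2) * enorm (y - X *m q) ^+ 2
  + iota * \sum_(i < d) (q i 0 ^+ 2 + eps ^+ 2) `^ (p / 2).

(* Main.v *)
Require Import Defs.
From HB Require Import structures.
From mathcomp Require Import all_boot all_order all_algebra.
From mathcomp Require Import all_classical all_reals all_analysis.
From mathcomp Require Import ring lra.
Set Implicit Arguments.
Unset Strict Implicit.
Unset Printing Implicit Defensive.
Import Order.TTheory GRing.Theory Num.Theory.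
Import numFieldNormedType.Exports.
Local Open Scope classical_set_scope.
Local Open Scope ring_scope.

(** Up to the linear map of the quadratic part, [grad U] acts coordinatewise by
    [iota * p * h] with [h t = t * (t^2 + eps^2)^(p/2 - 1)].  Since
    [h' t = (t^2 + eps^2)^(p/2 - 1) * (1 + (p - 2) * t^2 / (t^2 + eps^2))], where the
    second factor is in [0, 1], [h] is [eps^(p-2)]-Lipschitz by the mean value
    theorem.  Also [t * h t >= 0], so that dissipativity is decided by the quadratic
    part, and [h t ^ 2 <= (t^2)^(p-1)], which sums to the claimed sublinear bound by
    Jensen's inequality. *)

(** * Euclidean inner product, norm and operator norm *)

Section Vectors.
Context {R : realType}.

Lemma dotvE d (u v : 'cV[R]_d) : dotv u v = \sum_i u i 0 * v i 0.
Proof. by rewrite /dotv mxE; apply: eq_bigr => i _; rewrite mxE. Qed.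

Lemma dotvC d (u v : 'cV[R]_d) : dotv u v = dotv v u.
Proof. by rewrite !dotvE; apply: eq_bigr => i _; rewrite mulrC. Qed.

Lemma dotvDl d (u v w : 'cV[R]_d) : dotv (u + v) w = dotv u w + dotv v w.
Proof. by rewrite /dotv linearD/= mulmxDl mxE. Qed.

Lemma dotvZl d a (u w : 'cV[R]_d) : dotv (a *: u) w = a * dotv u w.
Proof. by rewrite /dotv linearZ/= -scalemxAl mxE. Qed.

Lemma dotvNl d (u w : 'cV[R]_d) : dotv (- u) w = - dotv u w.
Proof. by rewrite -scaleN1r dotvZl mulN1r. Qed.

Lemma dotvDr d (u v w : 'cV[R]_d) : dotv w (u + v) = dotv w u + dotv w v.
Proof. by rewrite dotvC dotvDl !(dotvC _ w). Qed.

Lemma dotvZr d a (u w : 'cV[R]_d) : dotv w (a *: u) = a * dotv w u.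
Proof. by rewrite dotvC dotvZl dotvC. Qed.

Lemma dotvNr d (u w : 'cV[R]_d) : dotv w (- u) = - dotv w u.
Proof. by rewrite dotvC dotvNl dotvC. Qed.

Definition dotv_linear := (dotvDl, dotvDr, dotvNl, dotvNr, dotvZl, dotvZr).

Lemma dotv_mulmxr n d (A : 'M[R]_(n, d)) u v :
  dotv u (A *m v) = dotv (A^T *m u) v.
Proof. by rewrite /dotv trmx_mul trmxK mulmxA. Qed.

Lemma dotv_ge0 d (u : 'cV[R]_d) : 0 <= dotv u u.
Proof. by rewrite dotvE sumr_ge0// => i _; rewrite -expr2 sqr_ge0. Qed.

Lemma dotv_eq0 d (u : 'cV[R]_d) : (dotv u u == 0) = (u == 0).
Proof.
apply/idP/eqP => [|->]; last by rewrite dotvE big1// => i _; rewrite mxE mul0r.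
rewrite dotvE psumr_eq0 => [/allP u0|i _]; last by rewrite -expr2 sqr_ge0.
apply/colP => i; rewrite mxE.
by have /= := u0 i (mem_index_enum i); rewrite mulf_eq0 orbb => /eqP.
Qed.

Lemma enorm_ge0 d (u : 'cV[R]_d) : 0 <= enorm u.
Proof. exact: sqrtr_ge0. Qed.

Lemma enorm_sqr d (u : 'cV[R]_d) : enorm u ^+ 2 = dotv u u.
Proof. by rewrite sqr_sqrtr// dotv_ge0. Qed.

Lemma enorm0 d : enorm (0 : 'cV[R]_d) = 0.
Proof. by apply/eqP; rewrite -sqrf_eq0 enorm_sqr dotv_eq0. Qed.

Lemma enorm_eq0 d (u : 'cV[R]_d) : (enorm u == 0) = (u == 0).
Proof. by rewrite -sqrf_eq0 enorm_sqr dotv_eq0. Qed.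

Lemma enormZ d a (u : 'cV[R]_d) : enorm (a *: u) = `|a| * enorm u.
Proof.
by rewrite /enorm dotvZl dotvZr mulrA -expr2 sqrtrM ?sqr_ge0// sqrtr_sqr.
Qed.

Lemma enormN d (u : 'cV[R]_d) : enorm (- u) = enorm u.
Proof. by rewrite -scaleN1r enormZ normrN1 mul1r. Qed.

(** Cauchy-Schwarz: with [a], [b] the norms and [c] the product, the squared norm of
    [b *: u - a *: v] is [2 * a * b * (a * b - c)]. Zero vectors are set aside so that [a * b] can
    be cancelled. *)
Lemma dotv_le d (u v : 'cV[R]_d) : dotv u v <= enorm u * enorm v.
Proof.
have [->|u0] := eqVneq u 0.
  by rewrite enorm0 mul0r dotvE big1// => i _; rewrite mxE mul0r.
have [->|v0] := eqVneq v 0.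
  by rewrite enorm0 mulr0 dotvE big1// => i _; rewrite mxE mulr0.
have a0 : 0 < enorm u by rewrite lt_def enorm_eq0 u0 enorm_ge0.
have b0 : 0 < enorm v by rewrite lt_def enorm_eq0 v0 enorm_ge0.
have := dotv_ge0 (enorm v *: u - enorm u *: v).
rewrite !dotv_linear -!enorm_sqr (dotvC v u) => h.
have ab0 := mulr_gt0 a0 b0.
rewrite -(ler_pM2l ab0) -subr_ge0.
move: h; set a := enorm u; set b := enorm v; set c := dotv u v => h.
nra.
Qed.

Lemma enorm_le d (u v : 'cV[R]_d) : dotv u u <= dotv v v -> enorm u <= enorm v.
Proof. exact: ler_wsqrtr. Qed.

Lemma enormD d (u v : 'cV[R]_d) : enorm (u + v) <= enorm u + enorm v.
Proof.
rewrite -(@ler_pXn2r _ 2)// ?nnegrE ?addr_ge0 ?enorm_ge0//.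
rewrite enorm_sqr !dotv_linear (dotvC v u) -!enorm_sqr.
have := dotv_le u v; lra.
Qed.

Lemma ler_norm_enorm d (u : 'cV[R]_d) i : `|u i 0| <= enorm u.
Proof.
rewrite -sqrtr_sqr ler_wsqrtr// dotvE (bigD1 i)//= -expr2 lerDl.
by rewrite sumr_ge0// => j _; rewrite -expr2 sqr_ge0.
Qed.

(** In the unit ball every coordinate is at most 1 in absolute value, so each entry of [A *m u] is
    bounded by the absolute row sum. This makes [sup] an actual upper bound. *)
Lemma opnorm_has_ubound n d (A : 'M[R]_(n, d)) :
  has_ubound [set enorm (A *m u) | u in [set u : 'cV[R]_d | enorm u <= 1]].
Proof.
exists (Num.sqrt (\sum_i (\sum_j `|A i j|) ^+ 2)) => _ [u /= u1 <-].
apply: ler_wsqrtr; rewrite dotvE; apply: ler_sum => i _.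
rewrite -expr2 -real_normK ?num_real// ler_pXn2r ?nnegrE ?sumr_ge0//.
rewrite mxE (le_trans (ler_norm_sum _ _ _))// ler_sum// => j _.
by rewrite normrM ler_piMr// (le_trans (ler_norm_enorm u j)).
Qed.

Lemma opnormP n d (A : 'M[R]_(n, d)) u : enorm (A *m u) <= opnorm A * enorm u.
Proof.
have [->|u0] := eqVneq u 0; first by rewrite mulmx0 !enorm0 mulr0.
have a0 : 0 < enorm u by rewrite lt_def enorm_eq0 u0 enorm_ge0.
rewrite -ler_pdivrMr// mulrC.
have -> : (enorm u)^-1 * enorm (A *m u) = enorm (A *m ((enorm u)^-1 *: u)).
  by rewrite -scalemxAr enormZ ger0_norm// invr_ge0 ltW.
apply: ub_le_sup; first exact: opnorm_has_ubound.
exists ((enorm u)^-1 *: u) => //=.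
rewrite enormZ ger0_norm ?invr_ge0 ?enorm_ge0// mulVf//; exact: lt0r_neq0.
Qed.

Lemma opnorm_ge0 n d (A : 'M[R]_(n, d)) : 0 <= opnorm A.
Proof.
apply: ub_le_sup; first exact: opnorm_has_ubound.
by exists 0; rewrite /= ?mulmx0 enorm0// ler01.
Qed.

End Vectors.

(** * Directional derivatives computed along lines *)

(** For nonzero [h] the difference quotient is exactly [a + h * b]. A polynomial identity thus
    yields the derivative of coordinates, squares and the least-squares term. *)
Lemma is_derive_quadratic {R : realType} (V : normedModType R) (f : V -> R)
    (q v : V) (a b : R) :
  (forall t, f (t *: v + q) = f q + t * a + t ^+ 2 * b) -> is_derive q v f a.
Proof.
move=> fE.
have h : h^-1 *: (f (h *: v + q) - f q) @[h --> 0^'] --> a.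
  apply: cvg_trans (_ : a + h * b @[h --> (0:R)^'] --> a).
    apply: near_eq_cvg; near=> h.
    have h0 : h != 0 by near: h; exact: nbhs_dnbhs_neq.
    by rewrite fE /GRing.scale/=; field.
  apply: cvg_within_filter.
  suff : a + h * b @[h --> (0 : R)] --> a + 0 * b by rewrite mul0r addr0.
  by apply: cvgD; [exact: cvg_cst|apply: cvgM; [exact: cvg_id|exact: cvg_cst]].
split; first by apply/cvg_ex; exists a.
exact/cvg_lim.
Unshelve. all: by end_near. Qed.

(** The two difference quotients coincide, so the one-variable chain rule becomes available for
    functions on column vectors. *)
Lemma is_derive_line {R : realType} (V : normedModType R) (f : V -> R)
    (q v : V) (a : R) :
  is_derive (0 : R) 1 (fun t => f (t *: v + q)) a -> is_derive q v f a.
Proof.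
have E : (fun h : R => h^-1 *: (f ((h *: (1 : R) + 0) *: v + q) - f (0 *: v + q)))
     = (fun h : R => h^-1 *: (f (h *: v + q) - f q)).
  by apply/funext => h; rewrite addr0 scale0r add0r /GRing.scale/= mulr1.
case; rewrite /derivable /derive /= E => d e.
by split.
Qed.

(** * Smoothness through a class closed under differentiation *)

Section Elementary.
Context {R : realType} {d : nat}.
Implicit Types f g : 'cV[R]_d -> R.

(* A class of functions that contains the potential and is closed under partial
   derivatives; all its members are thereby smooth. *)
Inductive elementary (eps : R) : ('cV[R]_d -> R) -> Prop :=
| elementary_cst c : elementary eps (fun=> c)
| elementary_coord i : elementary eps (fun q => q i 0)
| elementary_add f g : elementary eps f -> elementary eps g ->
    elementary eps (fun q => f q + g q)
| elementary_mul f g : elementary eps f -> elementary eps g ->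
    elementary eps (fun q => f q * g q)
| elementary_powR i a : elementary eps (fun q => (q i 0 ^+ 2 + eps ^+ 2) `^ a).

Lemma elementary_sum eps k (F : 'I_k -> 'cV[R]_d -> R) :
  (forall i, elementary eps (F i)) -> elementary eps (fun q => \sum_i F i q).
Proof.
elim: k F => [|k ih] F hF.
  by under eq_fun do rewrite big_ord0; exact: elementary_cst.
under eq_fun do rewrite big_ord_recl.
by apply: elementary_add => //; apply: ih.
Qed.

Lemma is_derive_coord (q v : 'cV[R]_d) i :
  is_derive q v (fun q => q i 0) (v i 0).
Proof.
by apply: (@is_derive_quadratic _ _ _ _ _ _ 0) => t; rewrite !mxE; ring.
Qed.

Lemma sqrD_gt0 (eps t : R) : 0 < eps -> 0 < t ^+ 2 + eps ^+ 2.
Proof. by move=> e0; rewrite ltr_wpDl ?sqr_ge0// exprn_gt0. Qed.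

Lemma is_derive_sqrD_powR (eps a t : R) : 0 < eps ->
  is_derive t 1 (fun t => (t ^+ 2 + eps ^+ 2) `^ a)
    (a * (t ^+ 2 + eps ^+ 2) `^ (a - 1) * (2 * t)).
Proof.
move=> e0.
apply: (@is_derive1_comp _ (fun x => x `^ a) (fun t => t ^+ 2 + eps ^+ 2)).
  exact/is_derive1_powR/sqrD_gt0.
apply: (@is_derive_quadratic _ _ _ _ _ _ 1) => s.
by rewrite /GRing.scale/=; ring.
Qed.

Lemma is_derive_coord_sqrD_powR (eps a : R) (q v : 'cV[R]_d) i : 0 < eps ->
  is_derive q v (fun q => (q i 0 ^+ 2 + eps ^+ 2) `^ a)
    (a * (q i 0 ^+ 2 + eps ^+ 2) `^ (a - 1) * (2 * q i 0) * v i 0).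
Proof.
move=> e0; apply: is_derive_line.
apply: (@is_derive1_comp _ (fun t => (t ^+ 2 + eps ^+ 2) `^ a)
         (fun t => (t *: v + q) i 0)).
  have -> : (0 *: v + q) i 0 = q i 0 by rewrite scale0r add0r.
  exact: is_derive_sqrD_powR.
apply: (@is_derive_quadratic _ _ _ _ _ _ 0) => s.
by rewrite !mxE /GRing.scale/=; ring.
Qed.

Lemma elementary_continuous eps f : 0 < eps -> elementary eps f -> continuous f.
Proof.
move=> e0; elim => {f} [c|i|f g _ cf _ cg|f g _ cf _ cg|i a] q.
- exact: cst_continuous.
- exact: coord_continuous.
- exact: cvgD (cf q) (cg q).
- exact: cvgM (cf q) (cg q).
- apply: (@continuous_comp _ _ _ (fun q : 'cV[R]_d => q i 0)
    (fun t => (t ^+ 2 + eps ^+ 2) `^ a)); first exact: coord_continuous.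
  apply: differentiable_continuous; apply/derivable1_diffP.
  exact: (ex_derive (is_derive := is_derive_sqrD_powR a _ e0)).
Qed.

(** Induction on the construction of [f]. Differentiating a power lowers its exponent by one, which
    is why the class admits every real exponent; [0 < eps] keeps the base positive. *)
Lemma elementary_derive eps f (v : 'cV[R]_d) : 0 < eps -> elementary eps f ->
  exists2 g, elementary eps g & forall q, is_derive q v f (g q).
Proof.
move=> e0; elim => {f} [c|i|f g ef [f' ef' hf] eg [g' eg' hg]
  |f g ef [f' ef' hf] eg [g' eg' hg]|i a].
- exists (fun=> 0); first exact: elementary_cst.
  by move=> q; exact: is_derive_cst.
- exists (fun=> v i 0) => [|q]; first exact: elementary_cst.
  exact: is_derive_coord.
- exists (fun q => f' q + g' q) => [|q]; first exact: elementary_add.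
  exact: is_deriveD.
- exists (fun q => f q * g' q + g q * f' q) => [|q].
    by apply: elementary_add; exact: elementary_mul.
  exact: is_deriveM.
- eexists; last by move=> q; exact: is_derive_coord_sqrD_powR.
  do !apply: elementary_mul; try exact: elementary_cst.
  + exact: elementary_powR.
  + exact: elementary_coord.
Qed.

Lemma elementary_smooth eps f : 0 < eps -> elementary eps f -> smooth f.
Proof.
move=> e0 ef k; elim: k f ef => [|k ih] f ef; split=> //;
  try exact: elementary_continuous ef.
move=> i; have [g eg fg] := elementary_derive (delta_mx i 0) e0 ef.
split=> [q|]; first exact: (ex_derive (is_derive := fg q)).
suff -> : partial f i = g by exact: ih.
by apply/funext => q; exact: (derive_val (is_derive := fg q)).
Qed.

End Elementary.

(** * Real powers: monotonicity, decay, Young and Jensen inequalities *)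

Section PowR.
Context {R : realType}.

(** The power is the inverse of the one with exponent [- a]. The base [x] must be positive, since
    zero to a nonzero exponent is zero by convention. *)
Lemma powR_ge0_anti (a : R) (x y : R) : a <= 0 -> 0 < x -> x <= y -> y `^ a <= x `^ a.
Proof.
move=> a0 x0 xy; have y0 := lt_le_trans x0 xy.
rewrite -[a]opprK !(powRN _ (- a)) lef_pV2 ?posrE ?powR_gt0//.
by apply: ge0_ler_powR => //; rewrite ?nnegrE ?oppr_ge0// ltW.
Qed.

Lemma sqr_powR (x a : R) : 0 <= x -> (x ^+ 2) `^ a = x `^ (2 * a).
Proof. by move=> x0; rewrite -powR_mulrn// -powRrM. Qed.

Lemma powR_sqr (x a : R) : (x `^ a) ^+ 2 = x `^ (a * 2).
Proof. by rewrite powRrM powR_mulrn// powR_ge0. Qed.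

Lemma powR_cvgy0 (a : R) : a < 0 -> r `^ a @[r --> +oo] --> (0 : R).
Proof.
move=> a0; pose b := - a; have b0 : 0 < b by rewrite oppr_gt0.
have -> : (fun r : R => r `^ a) = (fun r => (r `^ b)^-1).
  by apply/funext => r; rewrite -powRN opprK.
apply/(@gtr0_cvgV0 _ _ _ _ (fun r : R => r `^ b)).
  by near=> r; apply: powR_gt0; near: r; exact: nbhs_pinfty_gt.
apply/cvgryPgt => A; near=> r.
have := ler_norm A; move=> /le_lt_trans; apply.
(* Writing the bound as a [b]-th power turns the claim into [r] exceeding the [b]-th root of the
   absolute value of [A]. *)
have -> : `|A| = (`|A| `^ b^-1) `^ b.
  by rewrite -powRrM mulVf ?gt_eqF// powRr1.
apply: gt0_ltr_powR; rewrite ?nnegrE ?powR_ge0 ?ltW//;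
by near: r; exact: nbhs_pinfty_gt.
Unshelve. all: by end_near. Qed.

(** Young's inequality for the conjugate exponents [t^-1] and [(1 - t)^-1]. *)
Lemma powR_young (a s t : R) : 0 < t -> t < 1 -> 0 <= a -> 0 <= s ->
  a `^ t * s `^ (1 - t) <= t * a + (1 - t) * s.
Proof.
move=> t0 t1 a0 s0; have u0 : 0 < 1 - t by rewrite subr_gt0.
have := @conjugate_powR R (a `^ t) (s `^ (1 - t)) t^-1 (1 - t)^-1
  (powR_ge0 _ _) (powR_ge0 _ _).
rewrite !invr_gt0 !invrK -!powRrM !mulfV ?gt_eqF// !powRr1//.
by move=> /(_ t0 u0); rewrite addrC subrK (mulrC a) (mulrC s); apply.
Qed.

Lemma powR_le1D (x t : R) : 0 < t -> t < 1 -> 0 <= x -> x `^ t <= 1 + x.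
Proof.
move=> t0 t1 x0; have := powR_young t0 t1 x0 (@ler01 R).
by rewrite powR1 !mulr1 => /le_trans; apply; nra.
Qed.

(* Jensen's inequality for [x |-> x `^ t], from Young's inequality against the
   mean of the [x_i]. *)
Lemma sum_powR_le k (x : 'I_k -> R) (t : R) : 0 < t -> t < 1 ->
  (forall i, 0 <= x i) ->
  \sum_i x i `^ t <= k%:R `^ (1 - t) * (\sum_i x i) `^ t.
Proof.
move=> t0 t1 x0; set S := \sum_i x i.
have S0 : 0 <= S by exact: sumr_ge0.
(* The mean [s] must be positive to be cancelled below; if [S] is zero, all terms vanish. *)
have [S_eq0|S_neq0] := eqVneq S 0.
  rewrite big1 ?mulr_ge0 ?powR_ge0// => i _.
  have /eqP := S_eq0; rewrite psumr_eq0// => /allP /(_ i (mem_index_enum i))/=.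
  by move=> /eqP ->; rewrite powR0// gt_eqF.
have Sp : 0 < S by rewrite lt_def S_neq0.
have k0 : 0 < k%:R :> R.
  rewrite ltr0n lt0n; apply: contra S_neq0 => /eqP k0.
  by rewrite /S; case: k x x0 @S S0 Sp k0 => // x *; rewrite big_ord0.
pose s := S / k%:R; have s0 : 0 < s by exact: divr_gt0.
have sum_le : (\sum_i x i `^ t) * s `^ (1 - t) <= S.
  rewrite mulr_suml.
  (* The right-hand sides of Young's inequality add up to [t * S + (1 - t) * k * s], which is [S]
     because [k * s = S]. *)
  have -> : S = \sum_i (t * x i + (1 - t) * s).
    rewrite big_split/= -mulr_sumr sumr_const card_ord -mulr_natr -/S /s.
    by field; rewrite gt_eqF.
  by apply: ler_sum => i _; apply: powR_young => //; exact: ltW.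
rewrite -(ler_pM2r (powR_gt0 (1 - t) s0)) (le_trans sum_le)//.
have -> : k%:R `^ (1 - t) * S `^ t * s `^ (1 - t) = S; last by [].
rewrite mulrAC -powRM ?ltW// /s mulrC (mulrC k%:R) divfK ?gt_eqF//.
rewrite -powRD ?(gt_eqF Sp) ?implybT//.
by rewrite addrCA subrr addr0 powRr1.
Qed.

End PowR.

(** * The scalar force, and smoothness and gradient of the potential *)

Section Bridge.
Context {R : realType}.

(** The derivative of one penalty term of the potential, divided by [iota * p]. *)
Definition bridge_force (p eps t : R) : R := t * (t ^+ 2 + eps ^+ 2) `^ (p / 2 - 1).

Lemma is_derive_bridge_force (p eps t : R) : 0 < eps ->
  is_derive t 1 (bridge_force p eps)
    ((t ^+ 2 + eps ^+ 2) `^ (p / 2 - 1)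
     * (1 + (p - 2) * (t ^+ 2 / (t ^+ 2 + eps ^+ 2)))).
Proof.
move=> e0; have w0 := sqrD_gt0 t e0.
have := is_deriveM (is_derive_id t 1) (is_derive_sqrD_powR (p / 2 - 1) t e0).
move=> /is_derive_eq; apply; rewrite /GRing.scale/=.
(* Lowering the exponent by one is a division, which lets the common power be factored out. *)
have -> : (t ^+ 2 + eps ^+ 2) `^ (p / 2 - 1 - 1)
    = (t ^+ 2 + eps ^+ 2) `^ (p / 2 - 1) / (t ^+ 2 + eps ^+ 2).
  by rewrite powRB ?(gt_eqF w0) ?implybT// powRr1// ltW.
by field; rewrite gt_eqF.
Qed.

Lemma bridge_force_lip (p eps s t : R) : 1 < p -> p < 2 -> 0 < eps ->
  `|bridge_force p eps s - bridge_force p eps t| <= eps `^ (p - 2) * `|s - t|.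
Proof.
move=> p1 p2 e0; wlog st : s t / t <= s => [hwlog|].
  have [/hwlog//|/ltW /hwlog] := leP t s.
  by rewrite distrC (distrC s).
have [|c _ ->] := MVT_segment st (fun x _ => is_derive_bridge_force p x e0).
  apply: derivable_within_continuous => x _.
  exact: (ex_derive (is_derive := is_derive_bridge_force p x e0)).
have w0 := sqrD_gt0 c e0.
rewrite normrM ler_wpM2r// normrM ger0_norm ?powR_ge0//.
rewrite -[leRHS]mulr1 ler_pM// ?powR_ge0//.
  (* The first factor of the derivative has a negative exponent, so it is largest at [c = 0], where
     it equals the claimed constant. *)
  have -> : p - 2 = 2 * (p / 2 - 1) by field.
  rewrite -(sqr_powR _ (ltW e0)) powR_ge0_anti ?exprn_gt0//; first lra.
  by rewrite lerDr sqr_ge0.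
have : 0 <= c ^+ 2 / (c ^+ 2 + eps ^+ 2) by rewrite divr_ge0 ?sqr_ge0 ?ltW.
have : c ^+ 2 / (c ^+ 2 + eps ^+ 2) <= 1.
  by rewrite ler_pdivrMr// mul1r lerDl sqr_ge0.
set z := _ / _ => z1 z0; rewrite ler_norml; apply/andP; split; nra.
Qed.

(** The square is [t ^+ 2] times a power of [t ^+ 2 + eps ^+ 2] with negative exponent [p - 2];
    dropping [eps ^+ 2] increases that power, provided [t] is nonzero. *)
Lemma bridge_force_sqr_le (p eps t : R) : 1 < p -> p < 2 ->
  bridge_force p eps t ^+ 2 <= (t ^+ 2) `^ (p - 1).
Proof.
move=> p1 p2; rewrite /bridge_force.
have [->|t0] := eqVneq t 0; first by rewrite mul0r expr0n/= powR_ge0.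
have t2 : 0 < t ^+ 2 by rewrite lt_def sqrf_eq0 t0 sqr_ge0.
rewrite exprMn powR_sqr -(mulr_powRB1 (ltW t2)) ?subr_gt0//.
rewrite (ler_wpM2l (ltW t2))//.
have -> : (p / 2 - 1) * 2 = p - 1 - 1 by field.
by apply: powR_ge0_anti => //; [lra|rewrite lerDl sqr_ge0].
Qed.

Context {n d : nat} (p sigma iota eps : R) (X : 'M[R]_(n, d)) (y : 'cV[R]_n).

Let U := bridge_potential p sigma iota eps X y.

Definition bridge_force_vec (q : 'cV[R]_d) : 'cV[R]_d :=
  \col_i bridge_force p eps (q i 0).

Lemma bridge_potential_smooth : 0 < eps -> smooth U.
Proof.
move=> e0; apply: (elementary_smooth e0).
(* Expanding into coordinates, with subtraction as multiplication by [- 1], exhibits the potential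
   as built from the constructors of [elementary]. *)
have -> : U = fun q : 'cV[R]_d =>
    1 / (2 * sigma ^+ 2) * (\sum_k (y k 0 + - 1 * \sum_j X k j * q j 0)
                                 * (y k 0 + - 1 * \sum_j X k j * q j 0))
    + iota * \sum_(i < d) (q i 0 ^+ 2 + eps ^+ 2) `^ (p / 2).
  apply/funext => q; rewrite /U/bridge_potential enorm_sqr dotvE.
  by congr (_ * _ + _); apply: eq_bigr => k _; rewrite !mxE mulN1r.
apply: elementary_add; apply: elementary_mul; try exact: elementary_cst.
  apply: elementary_sum => k.
  have e : elementary eps (fun q : 'cV[R]_d => y k 0 + - 1 * \sum_j X k j * q j 0).
    apply: elementary_add; first exact: elementary_cst.
    apply: elementary_mul; first exact: elementary_cst.
    apply: elementary_sum => j.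
    by apply: elementary_mul; [exact: elementary_cst|exact: elementary_coord].
  exact: elementary_mul.
by apply: elementary_sum => i; exact: elementary_powR.
Qed.

Lemma bridge_potential_ge0 q : 0 <= iota -> 0 <= U q.
Proof.
move=> i0; rewrite /U/bridge_potential addr_ge0//.
  by rewrite mulr_ge0 ?sqr_ge0// divr_ge0// mulr_ge0// sqr_ge0.
by rewrite mulr_ge0// sumr_ge0// => i _; exact: powR_ge0.
Qed.

Lemma grad_bridge_potential q : 0 < eps -> 0 < sigma ->
  grad U q = (sigma ^+ 2)^-1 *: (X^T *m X *m q - X^T *m y)
             + (iota * p) *: bridge_force_vec q.
Proof.
move=> e0 s0; apply/colP => i; rewrite mxE /partial.
(* Both derivatives below are found as inner products with [v]; only at the end does pairing with
   [v] extract the coordinate [i]. *)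
set v := delta_mx i 0.
have h1 : is_derive q v (fun q => 1 / (2 * sigma ^+ 2) * enorm (y - X *m q) ^+ 2)
    ((sigma ^+ 2)^-1 * dotv (X^T *m X *m q - X^T *m y) v).
  have -> : dotv (X^T *m X *m q - X^T *m y) v = - dotv (y - X *m q) (X *m v).
    by rewrite dotv_mulmxr mulmxBr mulmxA !dotv_linear; ring.
  (* The residual is affine along the line, so its squared norm is quadratic in [t], with
     second-order coefficient given by [X *m v]. *)
  apply: (@is_derive_quadratic _ _ _ _ _ _
           (1 / (2 * sigma ^+ 2) * dotv (X *m v) (X *m v))) => t.
  have -> : y - X *m (t *: v + q) = (y - X *m q) - t *: (X *m v).
    by rewrite mulmxDr -scalemxAr opprD addrCA addrC.
  move: (y - X *m q) => r; rewrite !enorm_sqr !dotv_linear (dotvC (X *m v) r).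
  by field; rewrite gt_eqF.
have h2 : is_derive q v (fun q => \sum_(i < d) (q i 0 ^+ 2 + eps ^+ 2) `^ (p / 2))
    (p * dotv (bridge_force_vec q) v).
  have -> : p * dotv (bridge_force_vec q) v = \sum_j (p / 2
      * (q j 0 ^+ 2 + eps ^+ 2) `^ (p / 2 - 1) * (2 * q j 0) * v j 0).
    rewrite dotvE mulr_sumr; apply: eq_bigr => j _.
    by rewrite mxE /bridge_force; field.
  have -> : (fun q : 'cV[R]_d => \sum_(i < d) (q i 0 ^+ 2 + eps ^+ 2) `^ (p / 2))
      = \sum_(i < d) (fun q : 'cV[R]_d => (q i 0 ^+ 2 + eps ^+ 2) `^ (p / 2)).
    by apply/funext => u; rewrite fct_sumE.
  by apply: is_derive_sum => j; exact: is_derive_coord_sqrD_powR.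
have := is_deriveD h1 (is_deriveZ iota h2).
move=> /(@derive_val _ _ _ _ _ _ _) => Uv.
have -> : 'D_v U q = (sigma ^+ 2)^-1 * dotv (X^T *m X *m q - X^T *m y) v
    + iota * (p * dotv (bridge_force_vec q) v) by rewrite -Uv.
have dotv_v w : dotv w v = w i 0.
  rewrite dotvE (bigD1 i)//= big1 => [|j ji]; last by rewrite mxE (negPf ji) mulr0.
  by rewrite mxE !eqxx mulr1 addr0.
by rewrite !dotv_v !mxE; ring.
Qed.

End Bridge.

(** * Lipschitz bound, dissipativity and asymptotic linearity *)

Section BridgeBounds.
Context {R : realType} {n d : nat} (p sigma iota eps : R).
Context (X : 'M[R]_(n, d)) (y : 'cV[R]_n).
Context (hp1 : 1 < p) (hp2 : p < 2) (hsigma : 0 < sigma) (hiota : 0 < iota).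
Context (heps : 0 < eps).

Local Notation U := (bridge_potential p sigma iota eps X y).
Local Notation M := (opnorm (X^T *m X)).
Local Notation s2 := (sigma ^+ 2)^-1.
Local Notation H := (@bridge_force_vec R d p eps).

Let s2_gt0 : 0 < s2. Proof. by rewrite invr_gt0 exprn_gt0. Qed.
Let ip_gt0 : 0 < iota * p. Proof. exact: mulr_gt0 hiota (lt_trans ltr01 hp1). Qed.

Lemma loewner_gt_dotv (m : R) (u : 'cV[R]_d) : loewner_gt (X^T *m X) m%:M ->
  m * dotv u u <= dotv u (X^T *m X *m u).
Proof.
move=> [_ h]; have [->|u0] := eqVneq u 0.
  by rewrite mulmx0 /dotv mulmx0 !mxE mulr0.
have := h u u0.
by rewrite mulmxBl mul_scalar_mx !dotv_linear subr_gt0 => /ltW.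
Qed.

Lemma bridge_force_vec_lip q q' :
  enorm (H q - H q') <= eps `^ (p - 2) * enorm (q - q').
Proof.
have K0 := powR_ge0 eps (p - 2).
(* With the constant moved inside the norm, the claim follows coordinatewise from
   [bridge_force_lip], with no loss in the dimension. *)
rewrite -[X in X * _]ger0_norm// -enormZ; apply: enorm_le.
rewrite !dotvE; apply: ler_sum => i _; rewrite !mxE -!expr2.
rewrite -(real_normK (num_real (_ - _))) -(real_normK (num_real (_ * _))).
by rewrite lerXn2r ?nnegrE// normrM (ger0_norm K0) bridge_force_lip.
Qed.

Lemma bridge_grad_lip : elipschitz (M / sigma ^+ 2 + iota * p * eps `^ (p - 2)) (grad U).
Proof.
move=> q q'; rewrite !grad_bridge_potential//.
(* The constant vector [X^T *m y] cancels in the difference. *)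
rewrite (_ : _ - _ = s2 *: (X^T *m X *m (q - q')) + (iota * p) *: (H q - H q')).
  rewrite (le_trans (enormD _ _))// !enormZ (ger0_norm (ltW s2_gt0)) (ger0_norm (ltW ip_gt0)) mulrDl.
  apply: lerD; last by rewrite -mulrA ler_wpM2l ?bridge_force_vec_lip// ltW.
  by rewrite [leRHS]mulrAC [leRHS]mulrC ler_wpM2l ?opnormP// ltW.
by apply/colP => i; rewrite mulmxBr !mxE; ring.
Qed.

Lemma bridge_grad_dotv_ge (m : R) q : 0 < m -> loewner_gt (X^T *m X) m%:M ->
  m / (2 * sigma ^+ 2) * enorm q ^+ 2
    - enorm (X^T *m y) ^+ 2 / (2 * m * sigma ^+ 2) <= dotv (grad U q) q.
Proof.
move=> m0 hX; rewrite grad_bridge_potential// !dotv_linear.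
have Hq : 0 <= dotv (H q) q.
  rewrite dotvE sumr_ge0// => i _; rewrite mxE /bridge_force mulrAC -expr2.
  by rewrite mulr_ge0 ?sqr_ge0 ?powR_ge0.
have Xq := loewner_gt_dotv q hX; rewrite dotvC -enorm_sqr in Xq.
have b := dotv_le (X^T *m y) q.
rewrite -[leLHS]addr0 lerD//; last exact: mulr_ge0 (ltW ip_gt0) Hq.
(* Completing the square: the stated bound falls short of the Cauchy-Schwarz lower bound by exactly
   a nonnegative square. *)
have -> : m / (2 * sigma ^+ 2) * enorm q ^+ 2
    - enorm (X^T *m y) ^+ 2 / (2 * m * sigma ^+ 2)
  = s2 * (m * enorm q ^+ 2 - enorm (X^T *m y) * enorm q
     - (m * enorm q - enorm (X^T *m y)) ^+ 2 / (2 * m)).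
  by field; rewrite !gt_eqF.
rewrite ler_wpM2l ?(ltW s2_gt0)//.
have : 0 <= (m * enorm q - enorm (X^T *m y)) ^+ 2 / (2 * m).
  by rewrite divr_ge0 ?sqr_ge0// mulr_ge0// ltW.
lra.
Qed.

(** Dissipativity needs [U] dominated by a quadratic. The penalty is controlled because [p / 2 < 1],
    and the squared norm of [X *m q] is the inner product of [q] with [X^T *m X *m q]. *)
Lemma bridge_potential_le q : U q <= (s2 * M + iota) * enorm q ^+ 2
  + (s2 * enorm y ^+ 2 + iota * (d%:R * (1 + eps ^+ 2))).
Proof.
have Xq : enorm (X *m q) ^+ 2 <= M * enorm q ^+ 2.
  rewrite enorm_sqr dotv_mulmxr mulmxA (le_trans (dotv_le _ _))//.
  by rewrite expr2 mulrA ler_wpM2r ?enorm_ge0// opnormP.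
have yXq : enorm (y - X *m q) ^+ 2 <= 2 * (enorm y ^+ 2 + M * enorm q ^+ 2).
  have := enormD y (- (X *m q)); rewrite enormN => h.
  have := enorm_ge0 (y - X *m q).
  have := sqr_ge0 (enorm y - enorm (X *m q)).
  nra.
have w : \sum_(i < d) (q i 0 ^+ 2 + eps ^+ 2) `^ (p / 2)
    <= enorm q ^+ 2 + d%:R * (1 + eps ^+ 2).
  rewrite enorm_sqr dotvE mulr_natl -[X in _ + _ *+ X](card_ord d) -sumr_const
    -big_split/=.
  apply: ler_sum => i _; rewrite -expr2 addrCA.
  by apply: powR_le1D; [move: hp1; lra|move: hp2; lra|exact/ltW/sqrD_gt0].
rewrite /bridge_potential.
have -> : 1 / (2 * sigma ^+ 2) = s2 / 2 by field; rewrite gt_eqF.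
have := ler_wpM2l (ltW s2_gt0) yXq; have := ler_wpM2l (ltW hiota) w.
lra.
Qed.

Lemma bridge_dissipative (gamma m : R) : 0 < m -> loewner_gt (X^T *m X) m%:M ->
  dissipative gamma U.
Proof.
move=> m0 hX.
pose k1 := s2 * M + iota; pose k2 := s2 * enorm y ^+ 2 + iota * (d%:R * (1 + eps ^+ 2)).
pose k3 := enorm (X^T *m y) ^+ 2 / (2 * m * sigma ^+ 2).
pose k := m / (2 * sigma ^+ 2) / 2.
have M0 : 0 <= M by exact: opnorm_ge0.
have D0 : 0 < k1 + gamma ^+ 2 / 4.
  rewrite ltr_pwDl ?divr_ge0 ?sqr_ge0// ltr_wpDl// mulr_ge0//; exact: ltW.
have k_gt0 : 0 < k by rewrite !divr_gt0// mulr_gt0// exprn_gt0.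
have k2_ge0 : 0 <= k2.
  rewrite addr_ge0 ?(mulr_ge0 (ltW s2_gt0)) ?sqr_ge0//.
  by rewrite (mulr_ge0 (ltW hiota))// mulr_ge0// addr_ge0// sqr_ge0.
have k3_ge0 : 0 <= k3 by rewrite divr_ge0 ?sqr_ge0// !mulr_ge0 ?sqr_ge0// ltW.
(* Half the inner product of [q] and the gradient grows at least like [k * enorm q ^+ 2]; this [l]
   keeps the quadratic part of the other side below that and respects the cap [1 / 4]. *)
pose l := Num.min (1 / 4) (k / (k1 + gamma ^+ 2 / 4)).
have l0 : 0 < l by rewrite lt_min divr_gt0//= divr_gt0.
have lD : l * (k1 + gamma ^+ 2 / 4) <= k.
  by rewrite -ler_pdivlMr// ge_min lexx orbT.
(* The first two summands collect the constant terms of the two bounds; they are only known to be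
   nonnegative, and the [1] makes the sum positive. *)
exists l, (l * k2 + k3 / 2 + 1); split=> //.
- by rewrite ge_min lexx.
- apply: ltr_wpDl ltr01; apply: addr_ge0; last exact: divr_ge0.
  exact: mulr_ge0 (ltW l0) k2_ge0.
- move=> q; rewrite dotvC.
  have := bridge_grad_dotv_ge q m0 hX; rewrite -/k3.
  have := ler_wpM2l (ltW l0) (bridge_potential_le q); rewrite -/k1 -/k2.
  have := ler_wpM2r (sqr_ge0 (enorm q)) lD.
  have -> : m / (2 * sigma ^+ 2) = 2 * k by rewrite /k; field; rewrite gt_eqF.
  lra.
Qed.

Lemma enorm_bridge_force_vec q :
  enorm (H q) <= d%:R `^ ((2 - p) / 2) * enorm q `^ (p - 1).
Proof.
rewrite -(@ler_pXn2r _ 2)// ?nnegrE ?mulr_ge0 ?powR_ge0 ?enorm_ge0//.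
rewrite enorm_sqr exprMn !powR_sqr divfK// (mulrC (p - 1)).
rewrite -sqr_powR ?enorm_ge0// enorm_sqr !dotvE.
(* After squaring, Jensen's inequality applies with exponent [p - 1], which lies strictly between 0
   and 1. *)
have -> : 2 - p = 1 - (p - 1) by ring.
have le_i i : H q i 0 * H q i 0 <= (q i 0 * q i 0) `^ (p - 1).
  by rewrite mxE -!expr2 bridge_force_sqr_le.
rewrite (le_trans (ler_sum _ (fun i _ => le_i i)))//.
by apply: sum_powR_le => [||i]; [move: hp1; lra|move: hp2; lra|rewrite -expr2 sqr_ge0].
Qed.

(** Subtracting the linear part leaves a constant vector, bounded by [c0], and the force vector,
    whose norm grows at most like the power [p - 1] of [enorm q]. Dividing by [enorm q] gives the
    two terms of the rate. *)
Lemma bridge_asymptotically_linear (m : R) : 0 < m -> loewner_gt (X^T *m X) m%:M ->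
  asymptotically_linear_gradient U 1 ((1 / sigma ^+ 2) *: (X^T *m X))
    (fun r => (enorm (X^T *m y) / sigma ^+ 2
               + iota * p * Num.sqrt d%:R * eps `^ (p - 1)) / r
              + iota * p * d%:R `^ ((2 - p) / 2) * r `^ (p - 2)).
Proof.
move=> m0 hX.
set c0 := enorm _ / _ + _; set c1 := iota * p * _ `^ _.
have c0E : enorm (X^T *m y) / sigma ^+ 2 <= c0.
  by rewrite /c0 lerDl -mulrA (mulr_ge0 (ltW ip_gt0))// mulr_ge0 ?powR_ge0.
have c0_ge0 : 0 <= c0.
  by rewrite (le_trans _ c0E)// divr_ge0 ?enorm_ge0 ?sqr_ge0.
have c1_ge0 : 0 <= c1 by exact: mulr_ge0 (ltW ip_gt0) (powR_ge0 _ _).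
split.
- exact: ltr01.
- split=> [|u u0]; first by rewrite linearZ/= trmx_mul trmxK.
  rewrite -scalemxAl dotvZr div1r mulr_gt0//.
  apply: lt_le_trans (loewner_gt_dotv u hX).
  by rewrite mulr_gt0// lt_def dotv_eq0 u0 dotv_ge0.
- move=> r s r1 rs; have r0 := lt_le_trans ltr01 r1.
  have sp := lt_le_trans r0 rs.
  apply: lerD; apply: ler_wpM2l => //; first by rewrite lef_pV2 ?posrE.
  by apply: powR_ge0_anti => //; move: hp2; lra.
- have -> : (0 : R) = c0 * 0 + c1 * 0 by ring.
  apply: cvgD; apply: cvgM; try exact: cvg_cst.
    apply/(@gtr0_cvgV0 _ _ _ _ id); last exact: cvg_id.
    exact: nbhs_pinfty_gt.
  by apply: powR_cvgy0; move: hp2; lra.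
- move=> q q1; have r0 := lt_le_trans ltr01 q1.
  rewrite grad_bridge_potential//.
  rewrite (_ : _ - _ = - (s2 *: (X^T *m y)) + (iota * p) *: H q); last first.
    by apply/colP => i; rewrite -scalemxAl !mxE div1r; ring.
  rewrite (le_trans (enormD _ _))// enormN !enormZ (ger0_norm (ltW s2_gt0)) (ger0_norm (ltW ip_gt0)).
  rewrite mulrDl divfK ?gt_eqF//; apply: lerD; first by rewrite mulrC.
  (* Multiplication by the positive number [enorm q] raises the exponent from [p - 2] to [p - 1],
     matching [enorm_bridge_force_vec]. *)
  have -> : c1 * enorm q `^ (p - 2) * enorm q
      = iota * p * (d%:R `^ ((2 - p) / 2) * enorm q `^ (p - 1)).
    rewrite -(mulr_powRB1 (ltW r0) (_ : 0 < p - 1)) ?subr_gt0//.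
    by rewrite (_ : p - 1 - 1 = p - 2) /c1; ring.
  by rewrite ler_wpM2l ?enorm_bridge_force_vec// ltW.
Qed.

End BridgeBounds.

Theorem proposition5p6 (R : realType) (n d : nat) (gamma : R)
    (p sigma iota eps : R) (X : 'M[R]_(n, d)) (y : 'cV[R]_n) (m : R)
    (hgamma : 0 < gamma) (hp1 : 1 < p) (hp2 : p < 2)
    (hsigma : 0 < sigma) (hiota : 0 < iota) (heps : 0 < eps)
    (hm : 0 < m) (hX : loewner_gt (X^T *m X) m%:M) :
  let M := opnorm (X^T *m X) in
  let U := bridge_potential p sigma iota eps X y in
  let L := M / sigma ^+ 2 + iota * p * eps `^ (p - 2) in
  let c0 := enorm (X^T *m y) / sigma ^+ 2
            + iota * p * Num.sqrt d%:R * eps `^ (p - 1) in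
  let c1 := iota * p * d%:R `^ ((2 - p) / 2) in
  let Qinf := (1 / sigma ^+ 2) *: (X^T *m X) in
  let rho := fun r : R => c0 / r + c1 * r `^ (p - 2) in
  (smooth U /\ (forall q : 'cV[R]_d, 0 <= U q) /\ elipschitz L (grad U))
  /\
  (dissipative gamma U /\
   (forall q : 'cV[R]_d,
      m / (2 * sigma ^+ 2) * enorm q ^+ 2
        - enorm (X^T *m y) ^+ 2 / (2 * m * sigma ^+ 2)
      <= dotv (grad U q) q))
  /\
  asymptotically_linear_gradient U 1 Qinf rho.
Proof.
move=> M U L c0 c1 Qinf rho; split.
  split; first exact: bridge_potential_smooth.
  split=> [q|]; first by apply: bridge_potential_ge0; exact: ltW.
  exact: bridge_grad_lip.
split; last exact: bridge_asymptotically_linear hX.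
split; first exact: bridge_dissipative hX.
by move=> q; exact: bridge_grad_dotv_ge.
Qed.
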